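(* Let $f=2-x^{-1}-y^{-1}\in\mathbb{Z}[\mathbb{H}]$. Then the full $2$-shift $\Sigma_2=\{0,1\}^{\mathbb{H}}$ is a symbolic cover of $X_f$, i.e., there exists a left-shift-equivariant continuous surjective map $\xi\colon\Sigma_2\longrightarrow X_f$.
   Context: $\mathbb{H}$ is the discrete Heisenberg group of upper triangular unipotent integer $3\times3$ matrices, with the standard generators $x,y$ (ones in position $(1,2)$, resp. $(2,3)$) and central element $z=xyx^{-1}y^{-1}$. $\mathbb{T}=\mathbb{R}/\mathbb{Z}$. The left and right shift actions on $\mathbb{T}^{\mathbb{H}}$ are $(\lambda^\gamma x)_{\gamma'}=x_{\gamma^{-1}\gamma'}$ and $(\rho^\gamma x)_{\gamma'}=x_{\gamma'\gamma}$; for $f=\sum_\gamma f_\gamma\gamma\in\mathbb{Z}[\mathbb{H}]$, $\rho^f=\sum_\gamma f_\gamma\rho^\gamma$. The principal algebraic action $(X_f,\alpha_f)$ is given by the compact group $X_f=\ker\rho^f\subset\mathbb{T}^{\mathbb{H}}$ and $\alpha_f=$ the restriction of $\lambda$ to $X_f$. The left shift on $\{0,1\}^{\mathbb{H}}$ is $v\mapsto(v_{\gamma^{-1}\gamma'})_{\gamma'}$; $\Sigma_2$ carries the product topology. *)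

(* Defs.v *)
From HB Require Import structures.
From mathcomp Require Import all_boot all_order all_algebra ring.
From mathcomp Require Import finmap generic_quotient ring_quotient archimedean.
From mathcomp Require Import all_classical all_reals all_analysis.
(* The notations of monalg clash with those of MathComp-Analysis. *)
From mathcomp Require Import -(notations) monalg.

Set Implicit Arguments.
Unset Strict Implicit.
Unset Printing Implicit Defensive.

Import GRing.Theory Num.Theory.
Import numFieldNormedType.Exports.

Local Open Scope classical_set_scope.
Local Open Scope ring_scope.

Definition unitriangular (A : 'M[int]_3) : bool :=
  is_trig_mx A^T && [forall i, A i i == 1].

Record heisenberg := Heisenberg {
  heis_mx :> 'M[int]_3;
  heis_mxP : unitriangular heis_mx
}.

HB.instance Definition _ := [isSub for heis_mx].
HB.instance Definition _ := [Choice of heisenberg by <:].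

(* The unitriangular matrix with entries a, b, c in positions (1,2), (2,3),
   (1,3); only used to prove the closure properties below. *)
Definition heis_coord (a b c : int) : 'M[int]_3 :=
  1%:M + a *: delta_mx 0 1 + b *: delta_mx 1 2 + c *: delta_mx 0 2.

Lemma ord3P (P : 'I_3 -> Prop) : P 0 -> P 1 -> P 2 -> forall i, P i.
Proof.
move=> P0 P1 P2 [[|[|[|k]]] Hk] //.
- by rewrite (_ : Ordinal Hk = 0) //; apply/val_inj.
- by rewrite (_ : Ordinal Hk = 1) //; apply/val_inj.
- by rewrite (_ : Ordinal Hk = 2) //; apply/val_inj.
Qed.

Lemma heis_coordE a b c i j : heis_coord a b c i j =
  (i == j)%:R + a * ((i == 0) && (j == 1))%:R + b * ((i == 1) && (j == 2))%:R
  + c * ((i == 0) && (j == 2))%:R.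
Proof. by rewrite !mxE. Qed.

Lemma unitriangular_coord a b c : unitriangular (heis_coord a b c).
Proof.
apply/andP; split.
  apply/is_trig_mxP => j i; rewrite mxE; move: i j; apply: ord3P; apply: ord3P => // _;
    by rewrite heis_coordE /= !mulr0 !addr0.
apply/forallP; apply: ord3P; by rewrite heis_coordE /= !mulr0 !addr0.
Qed.

Lemma unitriangularE (A : 'M[int]_3) : unitriangular A ->
  A = heis_coord (A 0 1) (A 1 2) (A 0 2).
Proof.
move=> /andP[/is_trig_mxP lo /forallP di].
have {}lo (i j : 'I_3) : (j < i)%N -> A i j = 0.
  by move=> /lo; rewrite mxE.
have {}di i : A i i = 1 by exact/eqP.
apply/matrixP; apply: ord3P; apply: ord3P; rewrite heis_coordE /=
  ?mulr0 ?mulr1 ?addr0 ?add0r ?di //; exact: lo.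
Qed.

Lemma mul_heis_coord a b c a' b' c' :
  heis_coord a b c *m heis_coord a' b' c' =
  heis_coord (a + a') (b + b') (c + c' + a * b').
Proof.
apply/matrixP; apply: ord3P; apply: ord3P;
  rewrite mxE !big_ord_recl big_ord0 !heis_coordE /=; ring.
Qed.

Lemma heis_coord0 : heis_coord 0 0 0 = 1%:M.
Proof. by rewrite /heis_coord !scale0r !addr0. Qed.

Lemma unitriangularM (A B : heisenberg) : unitriangular (A *m B).
Proof.
rewrite (unitriangularE (heis_mxP A)) (unitriangularE (heis_mxP B)).
by rewrite mul_heis_coord unitriangular_coord.
Qed.

Lemma unitriangular1 : unitriangular 1%:M.
Proof. by rewrite -heis_coord0 unitriangular_coord. Qed.

Lemma heis_mx_inv (A : heisenberg) :
  A *m heis_coord (- A 0 1) (- A 1 2) (A 0 1 * A 1 2 - A 0 2) = 1%:M.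
Proof.
rewrite {1}(unitriangularE (heis_mxP A)) mul_heis_coord -heis_coord0.
by congr heis_coord; ring.
Qed.

Lemma heis_unitmx (A : heisenberg) : heis_mx A \in unitmx.
Proof. by have /mulmx1_unit[] := heis_mx_inv A. Qed.

Lemma unitriangularV (A : heisenberg) : unitriangular (invmx A).
Proof.
rewrite -[invmx A]mulmx1 -(heis_mx_inv A) mulmxA mulVmx ?heis_unitmx//.
by rewrite mul1mx unitriangular_coord.
Qed.

Definition heis_mul (A B : heisenberg) := Heisenberg (unitriangularM A B).
Definition heis_one := Heisenberg unitriangular1.
Definition heis_inv (A : heisenberg) := Heisenberg (unitriangularV A).

Lemma heis_mulA : associative heis_mul.
Proof. by move=> A B C; apply/val_inj; rewrite /= mulmxA. Qed.
Lemma heis_mul1 : left_id heis_one heis_mul.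
Proof. by move=> A; apply/val_inj; rewrite /= mul1mx. Qed.
Lemma heis_mulr1 : right_id heis_one heis_mul.
Proof. by move=> A; apply/val_inj; rewrite /= mulmx1. Qed.
Lemma heis_mulV : left_inverse heis_one heis_inv heis_mul.
Proof. by move=> A; apply/val_inj; rewrite /= mulVmx ?heis_unitmx. Qed.
Lemma heis_mulrV : right_inverse heis_one heis_inv heis_mul.
Proof. by move=> A; apply/val_inj; rewrite /= mulmxV ?heis_unitmx. Qed.

HB.instance Definition _ := isGroup.Build heisenberg
  heis_mulA heis_mul1 heis_mulr1 heis_mulV heis_mulrV.

Lemma heis_x_subproof : unitriangular (1%:M + delta_mx 0 1).
Proof.
have := unitriangular_coord 1 0 0.
by rewrite /heis_coord scale1r !scale0r !addr0.
Qed.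

Lemma heis_y_subproof : unitriangular (1%:M + delta_mx 1 2).
Proof.
have := unitriangular_coord 0 1 0.
by rewrite /heis_coord scale1r !scale0r !addr0.
Qed.

(* Matrix indices start at 0. *)
Definition heis_x : heisenberg := Heisenberg heis_x_subproof.
Definition heis_y : heisenberg := Heisenberg heis_y_subproof.

(* The set of integers in R, as a subgroup of the additive group R. *)
Definition integers (R : realType) : zmodClosed R :=
  GRing.ZmodClosed.clone R Num.int_num_subdef _.

(* R / Z, with the quotient group structure and the quotient topology. *)
Definition circle (R : realType) : Type :=
  quotient_topology (Quotient.quot (integers R)).

HB.instance Definition _ (R : realType) := Topological.on (circle R).
HB.instance Definition _ (R : realType) :=
  GRing.Zmodule.copy (circle R) (Quotient.quot (integers R)).

(* The elements of Z[G]: finitely supported functions G -> int. The ring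
   structure of monalg is not available (it excludes groups), but only the
   additive structure is needed. *)
Definition group_ring (G : groupType) : zmodType := malg G int.

(* n . g in Z[G] *)
Definition gr_mon (G : groupType) (n : int) (g : G) : group_ring G :=
  mkmalgU g n.

Section PrincipalAction.
Variables (R : realType) (G : groupType).

Definition left_shift (A : Type) (g : G) (v : {ptws G -> A}) : {ptws G -> A} :=
  fun h => v (g^-1 * h)%g.

Definition right_shift (A : Type) (g : G) (v : {ptws G -> A}) : {ptws G -> A} :=
  fun h => v (h * g)%g.

Definition rho (f : group_ring G) (v : {ptws G -> circle R}) :
    {ptws G -> circle R} :=
  fun h => \sum_(g <- msupp f) right_shift g v h *~ mcoeff g f.

(* As a type, Xspace f carries the subspace topology. *)
Definition Xspace (f : group_ring G) : set {ptws G -> circle R} :=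
  [set v | rho f v = fun=> 0].

Lemma Xspace_left_shift (f : group_ring G) (g : G) (v : {ptws G -> circle R}) :
  Xspace f v -> Xspace f (left_shift g v).
Proof.
rewrite /Xspace /= => fv; apply/funext => h.
have /(congr1 (fun u => u (g^-1 * h)%g)) /= <- := fv.
by apply: eq_bigr => k _; rewrite /right_shift /left_shift mulgA.
Qed.

Definition alpha (f : group_ring G) (g : G) (v : Xspace f) : Xspace f :=
  exist _ (left_shift g (\val v)) (mem_set (Xspace_left_shift g (set_valP v))).

End PrincipalAction.
Arguments Xspace R {G} f.

(* Main.v *)
(* Let [avg] be the average of the right translations by x^-1 and y^-1, so that
   f = 2 (1 - avg), and let z be the central element with xy = zyx. The series
   (1/2) sum_n avg^n converges only after multiplication by a power of 1 - z.
   In avg^2 the words x^-1 y^-1 and y^-1 x^-1 differ by z, so a positive fraction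
   of each factor avg^2 is a multiple of (1 + z) / 2; as
   ||(1 - z) ((1 + z) / 2)^n|| = O(n^(-1/2)), this yields
   ||avg^n (1 - z)^4|| = O(n^(-2)). The cover sends v to
   (1/2) sum_n avg^n (1 - z)^4 v modulo 1.

   Surjectivity: the height h |-> h_01 + h_12 turns 2 p(h) = p(h x^-1) + p(h y^-1)
   into a recursion from one level to the next. On the levels above -N a point of
   X_f can be divided by (1 - z)^4, and then be lifted to a real function P such
   that f P is {0, 1}-valued above level -N. The image of that binary
   configuration agrees with the given point up to an error, due to the starting
   level, which vanishes as N grows; compactness of the 2-shift concludes. *)
Require Import Defs.
From HB Require Import structures.
From mathcomp Require Import all_boot all_order all_algebra.
From mathcomp Require Import ring lra zify.
From mathcomp Require Import finmap generic_quotient ring_quotient.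
From mathcomp Require Import all_classical all_reals all_analysis.
From mathcomp Require Import -(notations) monalg.

Set Implicit Arguments.
Unset Strict Implicit.
Unset Printing Implicit Defensive.

Import Order.TTheory GRing.Theory Num.Theory.
Import numFieldNormedType.Exports.

Local Open Scope classical_set_scope.
Local Open Scope ring_scope.

(** * Averaging operators *)

Definition heis_elt (a b c : int) : heisenberg :=
  Heisenberg (unitriangular_coord a b c).

Definition heis_z : heisenberg := heis_elt 0 0 1.

Lemma heis_elt_eta (h : heisenberg) : h = heis_elt (h 0 1) (h 1 2) (h 0 2).
Proof. exact/val_inj/(unitriangularE (heis_mxP h)). Qed.

Lemma heis_eltM a b c a' b' c' : (heis_elt a b c * heis_elt a' b' c')%g =
  heis_elt (a + a') (b + b') (c + c' + a * b').
Proof. by apply/val_inj; rewrite /= mul_heis_coord. Qed.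

Lemma heis_elt01 a b c : heis_elt a b c 0 1 = a.
Proof. by rewrite heis_coordE /= !mulr0 mulr1 !addr0 add0r. Qed.

Lemma heis_elt12 a b c : heis_elt a b c 1 2 = b.
Proof. by rewrite heis_coordE /= !mulr0 mulr1 !addr0 add0r. Qed.

Lemma heis_elt02 a b c : heis_elt a b c 0 2 = c.
Proof. by rewrite heis_coordE /= !mulr0 mulr1 !add0r. Qed.

Lemma heis_1E : 1%g = heis_elt 0 0 0.
Proof. by apply/val_inj; rewrite /= heis_coord0. Qed.

Lemma heis_xVE : heis_x^-1%g = heis_elt (-1) 0 0.
Proof.
apply: (mulgI heis_x); rewrite mulgV {1}(heis_elt_eta heis_x) heis_eltM.
by apply/val_inj; rewrite /= -heis_coord0 !mxE.
Qed.

Lemma heis_yVE : heis_y^-1%g = heis_elt 0 (-1) 0.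
Proof.
apply: (mulgI heis_y); rewrite mulgV {1}(heis_elt_eta heis_y) heis_eltM.
by apply/val_inj; rewrite /= -heis_coord0 !mxE.
Qed.

Lemma heis_zC h : (heis_z * h = h * heis_z)%g.
Proof.
by rewrite (heis_elt_eta h) !heis_eltM; congr heis_elt; ring.
Qed.

Lemma heis_xyV : (heis_x^-1 * heis_y^-1 = heis_z * (heis_y^-1 * heis_x^-1))%g.
Proof. by rewrite heis_xVE heis_yVE !heis_eltM. Qed.

(** * Decay of avg^n (1 - z)^4 *)

Section Operators.
Variable R : realType.
Implicit Types (u v : heisenberg -> R) (h : heisenberg) (c s t : R) (n m k : nat).

Definition avg u h : R := (u (h * heis_x^-1)%g + u (h * heis_y^-1)%g) / 2.
Definition zdiff u h : R := u h - u (h * heis_z)%g.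
Definition zavg u h : R := (u h + u (h * heis_z)%g) / 2.
Definition bounded_by c u := forall h, `|u h| <= c.

Lemma zavg_zdiff u : zavg (zdiff u) = zdiff (zavg u).
Proof. by apply/funext => h; rewrite /zavg /zdiff; ring. Qed.

Lemma avg_zdiff u : avg (zdiff u) = zdiff (avg u).
Proof.
apply/funext => h; rewrite /avg /zdiff.
by rewrite -!(mulgA h) -!heis_zC !mulgA; ring.
Qed.

Lemma avg_zavg u : avg (zavg u) = zavg (avg u).
Proof.
apply/funext => h; rewrite /avg /zavg.
by rewrite -!(mulgA h) -!heis_zC !mulgA; ring.
Qed.

Lemma iter_comm (T : Type) (f g : T -> T) n x :
  (forall y, f (g y) = g (f y)) -> f (iter n g x) = iter n g (f x).
Proof. by move=> fg; elim: n => //= n IH; rewrite fg IH. Qed.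

Lemma bounded_avg c u : bounded_by c u -> bounded_by c (avg u).
Proof.
move=> bu h; rewrite /avg.
have := bu (h * heis_x^-1)%g; have := bu (h * heis_y^-1)%g.
by rewrite !ler_norml => /andP[? ?] /andP[? ?]; apply/andP; split; lra.
Qed.

Lemma bounded_zavg c u : bounded_by c u -> bounded_by c (zavg u).
Proof.
move=> bu h; rewrite /zavg.
have := bu h; have := bu (h * heis_z)%g.
by rewrite !ler_norml => /andP[? ?] /andP[? ?]; apply/andP; split; lra.
Qed.

Lemma bounded_iter_avg c u n : bounded_by c u -> bounded_by c (iter n avg u).
Proof. by move=> bu; elim: n => //= n; exact: bounded_avg. Qed.

Lemma bounded_iter_zavg c u n : bounded_by c u -> bounded_by c (iter n zavg u).
Proof. by move=> bu; elim: n => //= n; exact: bounded_zavg. Qed.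

(* Let S be a sum of n independent signs and z^j the corresponding shift, where
   j counts the signs equal to -1. The left-hand side is the expectation of
   (t + S) u(h z^j), and E (t + S)^2 = t^2 + n. *)
Lemma zdiff_zavg_moment u c s t n h : bounded_by c u -> 0 < s ->
  `|t * iter n zavg u h + n%:R / 2 * zdiff (iter n.-1 zavg u) h|
    <= c * ((t ^+ 2 + n%:R) / s + s) / 2.
Proof.
move=> bu s0; elim: n t h => [|n IH] t h.
  rewrite mul0r mul0r addr0 /= normrM addr0.
  (* AM-GM: |t| <= (t^2 / s + s) / 2. The free parameter [s] is optimized later. *)
  apply: (@le_trans _ _ (`|t| * c)); first by rewrite ler_wpM2l.
  have c0 : 0 <= c by apply: le_trans (bu 1%g).
  rewrite mulrC -mulrA ler_wpM2l//.
  rewrite -(ler_pM2r s0) -real_normK ?num_real//.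
  have -> : (`|t| ^+ 2 / s + s) / 2 * s = (`|t| ^+ 2 + s ^+ 2) / 2.
    by field; rewrite gt_eqF.
  have := sqr_ge0 (`|t| - s); nra.
(* Condition on one sign: it replaces t by t + 1, or t by t - 1 and h by hz. Since ((t + 1)^2 + (t -
   1)^2) / 2 = t^2 + 1, the second moment grows by one. *)
have -> : t * iter n.+1 zavg u h + n.+1%:R / 2 * zdiff (iter n zavg u) h =
  ((t + 1) * iter n zavg u h + n%:R / 2 * zdiff (iter n.-1 zavg u) h) / 2 +
  ((t - 1) * iter n zavg u (h * heis_z)%g
    + n%:R / 2 * zdiff (iter n.-1 zavg u) (h * heis_z)%g) / 2.
  case: n {IH} => [|n] /=; first by rewrite /zavg /zdiff; field.
  by set w := iter n zavg u; rewrite /zavg /zdiff -[n.+2%:R]natr1 -[n.+1%:R]natr1; field.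
apply: le_trans (ler_normD _ _) _.
rewrite !normrM (ger0_norm (_ : 0 <= 2^-1)) ?invr_ge0//.
have := IH (t + 1) h; have := IH (t - 1) (h * heis_z)%g.
rewrite -[n.+1%:R]natr1.
have -> : c * ((t ^+ 2 + (n%:R + 1)) / s + s) / 2 =
  (c * (((t + 1) ^+ 2 + n%:R) / s + s) / 2
    + c * (((t - 1) ^+ 2 + n%:R) / s + s) / 2) / 2.
  by field; rewrite gt_eqF.
lra.
Qed.

(** The moment bound for n + 1 signs at t = 0, with the optimal s = sqrt(n + 1). *)
Lemma bounded_zdiff_zavg u c n : bounded_by c u ->
  bounded_by (2 * c / Num.sqrt n.+1%:R) (zdiff (iter n zavg u)).
Proof.
move=> bu h; set s := Num.sqrt _.
have s0 : 0 < s by rewrite sqrtr_gt0.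
have sE : n.+1%:R = s ^+ 2 by rewrite sqr_sqrtr.
have := zdiff_zavg_moment 0 n.+1 h bu s0.
rewrite mul0r add0r normrM /= expr0n add0r sE ger0_norm ?divr_ge0 ?sqr_ge0//.
have -> : s ^+ 2 / s = s by field; rewrite gt_eqF.
move=> H; rewrite ler_pdivlMr// -(ler_pM2r s0).
by move: H; set a := `|_|; nra.
Qed.

(** Each of the four factors 1 - z is paired with k = n / 4 (rounded down) of the averages and gains
    2 / sqrt(k + 1). With n + 1 <= 4 (k + 1) the constant is 16 * 16 = 256. *)
Lemma bounded_zavg_zdiff4 u c n : bounded_by c u ->
  bounded_by (256 * c / n.+1%:R ^+ 2) (iter n zavg (iter 4 zdiff u)).
Proof.
move=> bu; set k := (n %/ 4)%N.
pose V v := zdiff (iter k zavg v).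
have VE : iter n zavg (iter 4 zdiff u) = iter (n %% 4) zavg (V (V (V (V u)))).
  have zC j v : iter j zavg (zdiff v) = zdiff (iter j zavg v).
    by apply/esym/iter_comm => w; rewrite zavg_zdiff.
  rewrite {1}(divn_eq n 4) addnC iterD -/k; congr iter.
  by rewrite /V /= !zC -!iterD !mulnS muln0 addn0 -!addnA.
have {}bV c' v : bounded_by c' v -> bounded_by (2 * c' / Num.sqrt k.+1%:R) (V v).
  exact: bounded_zdiff_zavg.
have c0 : 0 <= c by apply: le_trans (bu 1%g).
rewrite VE; apply: bounded_iter_zavg => h.
apply: le_trans (bV _ _ (bV _ _ (bV _ _ (bV _ _ bu))) h) _.
set s := Num.sqrt _; have s0 : 0 < s by rewrite sqrtr_gt0.
have sE : k.+1%:R = s ^+ 2 by rewrite sqr_sqrtr.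
have -> : 2 * (2 * (2 * (2 * c / s) / s) / s) / s = 16 * c / k.+1%:R ^+ 2.
  by rewrite sE; field; rewrite gt_eqF.
have nk : n.+1%:R <= 4 * k.+1%:R :> R.
  by rewrite -natrM ler_nat; rewrite /k; lia.
rewrite ler_pdivrMr ?exprn_gt0// mulrAC ler_pdivlMr ?exprn_gt0//.
rewrite -!mulrA; have := ler_wpM2l c0 (_ : n.+1%:R ^+ 2 <= (4 * k.+1%:R) ^+ 2 :> R).
rewrite ler_pXn2r ?nnegrE ?mulr_ge0// => /(_ nk); nra.
Qed.

(* The square of [avg] has the terms x^-2, y^-2 and the two commuting-up-to-z
   terms x^-1 y^-1, y^-1 x^-1, which combine into a shift of [zavg u]. *)
Lemma bounded_avg2 u c c' : bounded_by c u -> bounded_by c' (zavg u) ->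
  bounded_by ((c + c') / 2) (avg (avg u)).
Proof.
move=> bu bu' h.
have -> : avg (avg u) h =
  (u (h * heis_x^-1 * heis_x^-1)%g + u (h * heis_y^-1 * heis_y^-1)%g) / 4
   + zavg u (h * heis_y^-1 * heis_x^-1)%g / 2.
  by rewrite /avg /zavg -!(mulgA h) heis_xyV heis_zC; field.
have := bu (h * heis_x^-1 * heis_x^-1)%g; have := bu (h * heis_y^-1 * heis_y^-1)%g.
have := bu' (h * heis_y^-1 * heis_x^-1)%g.
by rewrite !ler_norml => /andP[? ?] /andP[? ?] /andP[? ?]; apply/andP; split; lra.
Qed.

(** Convexity puts the left-hand side above (t + 1/2)^-2; retreating from 1/2 to 1/4 leaves enough
    room when t >= 1. *)
Lemma inv_sqr_midpoint (t : R) : 1 <= t ->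
  (t ^- 2 + (t + 1) ^- 2) / 2 <= (t + 4^-1) ^- 2.
Proof.
move=> t1.
have t0 : 0 < t by lra.
have s0 : 0 < t + 1 by lra.
have r0 : 0 < t + 4^-1 by lra.
rewrite -[leRHS]div1r ler_pdivlMr ?exprn_gt0//.
have -> : (t ^- 2 + (t + 1) ^- 2) / 2 * (t + 4^-1) ^+ 2 =
  ((t + 1) ^+ 2 + t ^+ 2) * (t + 4^-1) ^+ 2 / (2 * t ^+ 2 * (t + 1) ^+ 2).
  by field; rewrite !gt_eqF.
rewrite ler_pdivrMr ?mulr_gt0 ?exprn_gt0//.
have : 0 <= (t - 1) * t * t by rewrite !mulr_ge0//; lra.
have : 0 <= (t - 1) * t by rewrite !mulr_ge0//; lra.
nra.
Qed.

(** One factor avg^2 averages the bounds for n and n + 1 applications of [zavg], so by the midpoint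
    inequality it counts as a quarter of a [zavg]. *)
Lemma bounded_zavg_avg2 u c m n :
  (forall k, bounded_by (c / k.+1%:R ^+ 2) (iter k zavg u)) ->
  bounded_by (c / (n.+1%:R + m%:R / 4) ^+ 2)
    (iter n zavg (iter m (avg \o avg) u)).
Proof.
move=> bu.
have c0 : 0 <= c.
  by have := bu 0%N 1%g; rewrite expr1n divr1; exact: le_trans.
elim: m n => [|m IH] n; first by rewrite mul0r addr0; exact: bu.
have -> : iter n zavg (iter m.+1 (avg \o avg) u) =
    avg (avg (iter n zavg (iter m (avg \o avg) u))).
  rewrite iterS /=; apply/esym; rewrite (iter_comm _ _ avg_zavg).
  exact: (iter_comm _ _ avg_zavg).
have b1 := IH n; have b2 := IH n.+1.
move=> h; apply: le_trans (bounded_avg2 b1 b2 h) _.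
rewrite -[n.+2%:R]natr1 -[m.+1%:R]natr1; set t := n.+1%:R + m%:R / 4.
have t1 : 1 <= t by rewrite ler_wpDr ?divr_ge0// ler1n.
have -> : n.+1%:R + 1 + m%:R / 4 = t + 1 by rewrite /t; ring.
have -> : n.+1%:R + (m%:R + 1) / 4 = t + 4^-1 by rewrite /t; field.
rewrite -mulrDr -mulrA ler_wpM2l//.
exact: inv_sqr_midpoint.
Qed.

(** The O(n^-2) decay is written as a telescoping difference, so that tails of the series sum in
    closed form. *)
Lemma bounded_avg_zdiff4 u c n : bounded_by c u ->
  bounded_by (128 * (256 * c) * (n.+1%:R^-1 - n.+2%:R^-1))
    (iter n avg (iter 4 zdiff u)).
Proof.
move=> bu.
have c0 : 0 <= c by apply: le_trans (bu 1%g).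
have bz := fun k => bounded_zavg_zdiff4 k bu.
have iter2 m v : iter m (avg \o avg) v = iter m.*2 avg v.
  by elim: m => //= m ->.
set m := n./2.
have -> : iter n avg (iter 4 zdiff u) =
    iter (odd n) avg (iter m (avg \o avg) (iter 4 zdiff u)).
  by rewrite iter2 -iterD odd_double_half.
apply: bounded_iter_avg => h.
apply: le_trans (bounded_zavg_avg2 m 0 bz h) _.
have nm : n.+2%:R <= 8 * (1 + m%:R / 4) :> R.
  have -> : 8 * (1 + m%:R / 4) = (8 + m * 2)%:R :> R by rewrite natrD natrM; field.
  by rewrite ler_nat /m; lia.
set a := 1 + m%:R / 4 in nm *.
have a0 : 0 < a by rewrite ltr_wpDr ?divr_ge0.
have n0 : 0 < n.+1%:R :> R by [].
have n1 : n.+2%:R = n.+1%:R + 1 :> R by rewrite natr1.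
rewrite n1 in nm *; set b := n.+1%:R in n0 nm *.
have -> : b^-1 - (b + 1)^-1 = (b * (b + 1))^-1 by field; rewrite !gt_eqF; lra.
rewrite ler_pdivlMr ?mulr_gt0//; last by lra.
rewrite mulrAC ler_pdivrMr ?exprn_gt0// -!mulrA.
have : b * (b + 1) <= 64 * a ^+ 2 by nra.
move=> /(ler_wpM2l c0); nra.
Qed.

End Operators.

Arguments avg {R} u h.
Arguments zdiff {R} u h.
Arguments zavg {R} u h.

(** * The potential *)

Section PotentialTheory.
Variable R : realType.
Implicit Types (u v p q : heisenberg -> R) (h : heisenberg) (c : R) (n m k : nat).

Definition partial_potential u n h : R :=
  (\sum_(i < n) iter i avg (iter 4 zdiff u) h) / 2.

Definition potential u h : R := lim (partial_potential u n h @[n --> \oo]).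

Lemma partial_potential_tail u c m n h : bounded_by c u -> (m <= n)%N ->
  `|partial_potential u n h - partial_potential u m h| <= 64 * (256 * c) / m.+1%:R.
Proof.
move=> bu /subnKC <-; move: (n - m)%N => {}n.
have c0 : 0 <= c by apply: le_trans (bu 1%g).
suff : `|partial_potential u (m + n) h - partial_potential u m h|
    <= 64 * (256 * c) * (m.+1%:R^-1 - (m + n).+1%:R^-1).
  move/le_trans; apply; rewrite ler_wpM2l ?(mulr_ge0 _ (mulr_ge0 _ c0))// lerBlDr lerDl.
  by rewrite invr_ge0.
elim: n => [|n IH]; first by rewrite addn0 !subrr normr0 mulr0.
rewrite addnS {1}/partial_potential big_ord_recr /= mulrDl addrAC.
rewrite -/(partial_potential _ _ _).
apply: le_trans (ler_normD _ _) _.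
rewrite normrM (ger0_norm (_ : 0 <= 2^-1)) ?invr_ge0//.
move: IH (bounded_avg_zdiff4 (m + n) bu h) => /=.
set x := `|_ - _|; set y := `|iter _ _ _ _|.
by move: x y (_^-1) (_^-1) (_^-1) => x y i j k; lra.
Qed.

Lemma is_cvg_partial_potential u c h : bounded_by c u ->
  cvg (partial_potential u n h @[n --> \oo]).
Proof.
move=> bu; apply/cauchy_cvgP/cauchy_exP => e e0.
pose N := Num.truncn (64 * (256 * c) / e).
exists (partial_potential u N h); exists N => // n /= Nn.
rewrite /ball /= distrC.
apply: le_lt_trans (partial_potential_tail h bu Nn) _.
by rewrite ltr_pdivrMr// [e * _]mulrC -ltr_pdivrMr//; exact: truncnS_gt.
Qed.

Lemma potential_approx u c n h : bounded_by c u ->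
  `|potential u h - partial_potential u n h| <= 64 * (256 * c) / n.+1%:R.
Proof.
move=> bu; have cu := is_cvg_partial_potential (h := h) bu.
have cN : `|partial_potential u k h - partial_potential u n h| @[k --> \oo] -->
    `|potential u h - partial_potential u n h|.
  by apply: cvg_norm; apply: cvgB => //; exact: cvg_cst.
rewrite -(cvg_lim _ cN)//; apply: limr_le; first exact: cvgP cN.
near=> k; apply: partial_potential_tail => //.
by near: k; exact: nbhs_infty_ge.
Unshelve. all: by end_near. Qed.

Lemma norm_le_inv_eq0 (a c : R) : (forall n, `|a| <= c / n.+1%:R) -> a = 0.
Proof.
move=> ac; apply/eqP; rewrite -normr_eq0; apply/eqP/le_anti; rewrite normr_ge0 andbT.
rewrite leNgt; apply/negP => a0.
have := ac (Num.truncn (c / `|a|)).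
rewrite ler_pdivlMr// leNgt => /negP; apply.
by rewrite mulrC -ltr_pdivrMr//; exact: truncnS_gt.
Qed.

(** Telescoping of the geometric series in [avg]. *)
Lemma partial_potential_avg u n h :
  partial_potential u n h - avg (partial_potential u n) h =
  (iter 4 zdiff u h - iter n avg (iter 4 zdiff u) h) / 2.
Proof.
rewrite /avg /partial_potential; elim: n => [|n IH].
  by rewrite !big_ord0 /= subrr; field.
rewrite !big_ord_recr /=; move: IH => /=.
set w := zdiff _; set t := iter n avg w; rewrite /avg; lra.
Qed.

(** The potential solves f w = (1 - z)^4 u. For integer-valued u the right-hand side is an integer,
    which puts w modulo 1 into X_f. *)
Lemma potential_avg u c h : bounded_by c u ->
  2 * (potential u h - avg (potential u) h) = iter 4 zdiff u h.
Proof.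
move=> bu; apply/eqP; rewrite -subr_eq0; apply/eqP.
(* Truncating the potential at [h], truncating it at the two neighbours, and the remainder avg^n (1
   - z)^4 u each cost at most twice 64 * 256 c / (n + 1). *)
apply: (@norm_le_inv_eq0 _ (6 * (64 * (256 * c)))) => n.
have c0 : 0 <= c by apply: le_trans (bu 1%g).
have := bounded_avg_zdiff4 n bu h; have := partial_potential_avg u n h.
set w := iter 4 zdiff u; set t := iter n avg w; rewrite /avg.
have := potential_approx n h bu; have := potential_approx n (h * heis_x^-1)%g bu.
have := potential_approx n (h * heis_y^-1)%g bu.
have : 0 <= c * n.+2%:R^-1 by rewrite mulr_ge0// invr_ge0.
move: (n.+1%:R^-1) (n.+2%:R^-1) => i j.
rewrite !ler_norml => cj /andP[? ?] /andP[? ?] /andP[? ?] ? /andP[? ?].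
by apply/andP; split; lra.
Qed.

Lemma iter_zdiff_shift u g n :
  iter n zdiff (fun h => u (g * h)%g) =
  fun h => iter n zdiff u (g * h)%g.
Proof. by elim: n => //= n ->; apply/funext => h; rewrite /zdiff mulgA. Qed.

Lemma iter_avg_shift u g n :
  iter n avg (fun h => u (g * h)%g) = fun h => iter n avg u (g * h)%g.
Proof. by elim: n => //= n ->; apply/funext => h; rewrite /avg !mulgA. Qed.

(** Only right translations enter the potential, and they commute with left ones; this gives
    equivariance. *)
Lemma potential_shift u g h : potential (fun h => u (g * h)%g) h = potential u (g * h)%g.
Proof.
rewrite /potential.
suff -> : (fun n => partial_potential (fun h => u (g * h)%g) n h) =
  (fun n => partial_potential u n (g * h)%g) by [].
apply/funext => n; rewrite /partial_potential; congr (_ / 2); apply: eq_bigr => i _.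
by rewrite iter_zdiff_shift iter_avg_shift.
Qed.

(** This form of linearity serves both the defect 2 (u - avg u) and, with a = 1, plain
    differences. *)
Lemma iter_zdiff_lin n (a : R) u v :
  iter n zdiff (fun h => a * (u h - v h)) =
  fun h => a * (iter n zdiff u h - iter n zdiff v h).
Proof. by elim: n => //= n ->; apply/funext => h; rewrite /zdiff; ring. Qed.

Lemma iter_avg_lin n (a : R) u v :
  iter n avg (fun h => a * (u h - v h)) =
  fun h => a * (iter n avg u h - iter n avg v h).
Proof. by elim: n => //= n ->; apply/funext => h; rewrite /avg; field. Qed.

Lemma partial_potential_lin (a : R) u v n h :
  partial_potential (fun h => a * (u h - v h)) n h =
  a * (partial_potential u n h - partial_potential v n h).
Proof.
rewrite /partial_potential -mulrBl mulrA -sumrB mulr_sumr.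
congr (_ / 2); apply: eq_bigr => i _.
by rewrite iter_zdiff_lin iter_avg_lin.
Qed.

(** Recovers (1 - z)^4 u from the defect f u. The remainder disappears for large n when u vanishes
    below some level. *)
Lemma partial_potential_defect u n h :
  partial_potential (fun h => 2 * (u h - avg u h)) n h =
  iter 4 zdiff u h - iter n avg (iter 4 zdiff u) h.
Proof.
rewrite partial_potential_lin.
have -> : partial_potential (avg u) n h = avg (partial_potential u n) h.
  rewrite [RHS]/avg /partial_potential -mulrDl; congr (_ / 2).
  rewrite -big_split mulr_suml; apply: eq_bigr => i _.
  have -> : iter i avg (iter 4 zdiff (avg u)) = avg (iter i avg (iter 4 zdiff u)).
    by rewrite /= -!avg_zdiff -iterS iterSr.
  by [].
by rewrite partial_potential_avg; field.
Qed.

End PotentialTheory.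

(** * Solutions above a level *)

(** The homomorphism to the integers with x, y sent to 1 and z to 0: [avg] reads the level just
    below, [zdiff] stays on its level. *)
Definition lev (h : heisenberg) : int := h 0 1 + h 1 2.

Lemma lev_elt a b c : lev (heis_elt a b c) = a + b.
Proof. by rewrite /lev heis_elt01 heis_elt12. Qed.

Lemma levM g h : lev (g * h)%g = lev g + lev h.
Proof.
rewrite (heis_elt_eta g) (heis_elt_eta h) heis_eltM !lev_elt; ring.
Qed.

Lemma lev_xV h : lev (h * heis_x^-1)%g = lev h - 1.
Proof. by rewrite levM heis_xVE lev_elt addr0. Qed.

Lemma lev_yV h : lev (h * heis_y^-1)%g = lev h - 1.
Proof. by rewrite levM heis_yVE lev_elt add0r. Qed.

Lemma lev_z h : lev (h * heis_z)%g = lev h.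
Proof. by rewrite levM lev_elt !addr0. Qed.

Section Slab.
Variable R : realType.
Implicit Types (u p q : heisenberg -> R) (h : heisenberg) (l : int) (n m k : nat).

Definition harmonic_above l u :=
  forall h, l < lev h -> 2 * (u h - avg u h) \is a Num.int.

(** A discrete antiderivative F with F(0) = 0, signed to match [zdiff]: F(c) - F(c + 1) = f(c). *)
Definition antidiff (f : int -> R) (c : int) : R :=
  match c with
  | Posz n => - \sum_(i < n) f i%:Z
  | Negz n => \sum_(i < n.+1) f (Negz i)
  end.

Lemma antidiff0 f : antidiff f 0 = 0.
Proof. by rewrite /= big_ord0 oppr0. Qed.

Lemma antidiffE f c : antidiff f c - antidiff f (c + 1) = f c.
Proof.
case: c => n.
  by rewrite -PoszD addn1 /= big_ord_recr /=; ring.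
have -> : Negz n + 1 = - n%:Z by rewrite NegzE; lia.
case: n => [|n]; first by rewrite oppr0 /= big_ord0 big_ord1; ring.
by rewrite -NegzE /= [X in X - _]big_ord_recr /=; ring.
Qed.

Lemma int_chain (f : int -> R) c : f 0 \is a Num.int ->
  (forall i, f i - f (i + 1) \is a Num.int) -> f c \is a Num.int.
Proof.
move=> f0 df; case: c.
  elim=> // n IH; have := df n; rewrite -PoszD addn1.
  by move=> /(rpredB IH); rewrite opprB addrC subrK.
elim=> [|n IH].
  by have := rpredD (df (-1)) f0; rewrite addNr subrK NegzE.
have := rpredD (df (Negz n.+1)) IH.
by rewrite (_ : Negz n.+1 + 1 = Negz n) ?subrK// !NegzE; lia.
Qed.

(** Constants of integration along the z-cosets, for the coset with first coordinate [a] on level l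
    + n. They are chosen so that f q = 0 at z-coordinate 0; there the neighbour h y^-1 has
    z-coordinate -a, whence the [antidiff] term. *)
Fixpoint slab_base p l n (a : int) : R :=
  if n is m.+1 then
    (slab_base p l m (a - 1) + slab_base p l m a
     + antidiff (fun c => p (heis_elt a (l + m%:Z - a) c)) (- a)) / 2
  else 0.

(* Dual to the fact that 1 - z is not a zero divisor modulo f. *)
Lemma zdiff_onto_harmonic l p : harmonic_above l p ->
  exists2 q, harmonic_above l q & zdiff q = p.
Proof.
move=> hp.
(* The second summand is constant along z, so [zdiff q = p] for any choice of it, also at and below
   level [l], where its value does not matter. *)
pose q h := antidiff (fun c => p (heis_elt (h 0 1) (h 1 2) c)) (h 0 2)
  + slab_base p l `|(lev h - l)%R|%N (h 0 1).
have qE a b c : q (heis_elt a b c) =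
    antidiff (fun i => p (heis_elt a b i)) c + slab_base p l `|(a + b - l)%R|%N a.
  by rewrite /q heis_elt01 heis_elt12 heis_elt02 lev_elt.
have zq : zdiff q = p.
  apply/funext => h; rewrite (heis_elt_eta h) /zdiff heis_eltM !qE.
  rewrite !addr0 mulr0 addr0 opprD addrACA subrr addr0.
  exact: antidiffE.
exists q => // h; rewrite (heis_elt_eta h).
move: (h 0 1) (h 1 2) (h 0 2) => a b c; rewrite lev_elt => lh.
(* Along a z-coset the defect of [q] has as differences the defects of [p], which are integers; so
   only i = 0 needs checking, and there the defect is 0. *)
pose f i := 2 * (q (heis_elt a b i) - avg q (heis_elt a b i)).
rewrite -/(f c); apply: int_chain => [|i].
  rewrite /f /avg heis_xVE heis_yVE !heis_eltM !qE.
  rewrite !addr0 !add0r mulr0 mulrN1 !antidiff0 add0r.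
  have [m am] : exists m : nat, a + b - l = m.+1%:Z.
    by exists `|(a + b - l - 1)%R|%N; lia.
  have -> : a - 1 + b - l = m%:Z by lia.
  have -> : a + (b - 1) - l = m%:Z by lia.
  rewrite am /= (_ : l + m%:Z - a = b - 1); last by lia.
  by rewrite (_ : 2 * _ = 0) ?rpred0//; field.
have -> : f i - f (i + 1) =
    2 * (p (heis_elt a b i) - avg p (heis_elt a b i)).
  rewrite -zq avg_zdiff /f {2}/zdiff {1}/zdiff heis_eltM !addr0 mulr0 addr0; ring.
by apply: hp; rewrite lev_elt.
Qed.

Lemma iter_zdiff_onto_harmonic n l p : harmonic_above l p ->
  exists2 q, harmonic_above l q & iter n zdiff q = p.
Proof.
elim: n p => [|n IH] p hp; first by exists p.
have [q hq <-] := zdiff_onto_harmonic hp.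
by have [q' hq' <-] := IH q hq; exists q'.
Qed.

Fixpoint slab_lift p n h : R :=
  if n is m.+1 then
    let b := avg (slab_lift p m) h in
    if p h - b \is a Num.int then b else b + 2^-1
  else p h - (Num.floor (p h))%:~R.

Lemma half_int (x : R) : 2 * x \is a Num.int -> x \isn't a Num.int ->
  x - 2^-1 \is a Num.int.
Proof.
move=> /intrP[m mE] xN.
have [k [mk|mk]] : exists k : int, m = 2 * k \/ m = 2 * k + 1.
  by exists (m %/ 2)%Z; lia.
- case/negP: xN; rewrite (_ : x = k%:~R) ?intr_int//.
  by move: mE; rewrite mk intrM; lra.
- rewrite (_ : _ - _ = k%:~R) ?intr_int//.
  by move: mE; rewrite mk intrD intrM; lra.
Qed.

(* A binary choice at each site: both halves of an element of R/Z are allowed,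
   so a lift can be chosen whose defect [2 - x^-1 - y^-1] takes values 0, 1. *)
Lemma binary_lift l p : harmonic_above l p -> exists P : heisenberg -> R,
  [/\ forall h, l <= lev h -> P h - p h \is a Num.int,
      forall h, lev h < l -> P h = 0,
      forall h, lev h = l -> 0 <= P h <= 1 &
      forall h, l < lev h ->
        2 * (P h - avg P h) = 0 \/ 2 * (P h - avg P h) = 1].
Proof.
move=> hp.
have [P P0 PE] : exists2 P : heisenberg -> R, forall h, lev h < l -> P h = 0 &
    forall n h, lev h = l + n%:Z -> P h = slab_lift p n h.
  exists (fun h => if lev h < l then 0 else slab_lift p `|(lev h - l)%R|%N h).
    by move=> h ->.
  by move=> n h ->; rewrite ltNge lerDl /= addrC addKr.
have avgP n h : lev h = l + n.+1%:Z -> avg P h = avg (slab_lift p n) h.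
  by move=> lh; rewrite /avg !(PE n)// ?lev_xV ?lev_yV; lia.
have lP n h : lev h = l + n%:Z -> P h - p h \is a Num.int.
  elim: n h => [|n IH] h lh; rewrite (PE _ _ lh) /=.
    by rewrite addrAC subrr add0r rpredN intr_int.
  rewrite -(avgP _ _ lh).
  case: ifPn => [|pN]; first by rewrite -opprB rpredN.
  have xi : - (p h - avg P h - 2^-1) \is a Num.int.
    rewrite rpredN.
    (* Modulo 1, [P] agrees with [p] at both lower neighbours, so 2 (p - avg P) is an integer. *)
    apply: half_int => //.
    have hph : 2 * (p h - avg p h) \is a Num.int by apply: hp; rewrite lh; lia.
    have lx : lev (h * heis_x^-1)%g = l + n%:Z by rewrite lev_xV lh; lia.
    have ly : lev (h * heis_y^-1)%g = l + n%:Z by rewrite lev_yV lh; lia.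
    have := rpredB hph (rpredD (IH _ lx) (IH _ ly)).
    by congr (_ \is a Num.int); rewrite /avg; field.
  by move: xi; congr (_ \is a Num.int); field.
exists P; split=> [h lh|h lh|h lh|h lh].
- by apply: (lP `|(lev h - l)%R|%N); lia.
- exact: P0.
- rewrite (PE 0%N) ?lh ?addr0//=.
  by have /andP[] := floor_itv (p h); rewrite intrD; lra.
- have [n ln] : exists n : nat, lev h = l + n.+1%:Z.
    by exists `|(lev h - l - 1)%R|%N; lia.
  rewrite (PE _ _ ln) (avgP _ _ ln) /=.
  by case: ifP => _; [left|right]; lra.
Qed.

End Slab.

(** * Approximation by potentials of binary configurations *)

Section Approximation.
Variable R : realType.
Implicit Types (u v p q : heisenberg -> R) (h : heisenberg) (l : int) (n : nat).

(** Translation by z preserves levels, so any set of values closed under subtraction is inherited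
    level by level. *)
Lemma iter_zdiff_lev (D : int -> Prop) (E : {pred R}) n u :
  (forall x y, x \in E -> y \in E -> x - y \in E) ->
  (forall h, D (lev h) -> u h \in E) ->
  forall h, D (lev h) -> iter n zdiff u h \in E.
Proof.
move=> EB uE; elim: n => //= n IH h Dh.
by apply: EB; apply: IH; rewrite ?lev_z.
Qed.

Lemma iter_avg_lev0 (D : int -> Prop) n u h :
  (forall h, D (lev h) -> u h = 0) -> D (lev h - n%:Z) -> iter n avg u h = 0.
Proof.
move=> u0; elim: n h => [|n IH] h; first by rewrite subr0; exact: u0.
move=> Dh; rewrite /= /avg !IH ?addr0 ?mul0r// ?lev_xV ?lev_yV.
all: by move: Dh; congr D; lia.
Qed.

Lemma iter_zdiff_lev0 (D : int -> Prop) n u :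
  (forall h, D (lev h) -> u h = 0) ->
  forall h, D (lev h) -> iter n zdiff u h = 0.
Proof.
move=> u0 h Dh; apply/eqP.
apply: (@iter_zdiff_lev D (pred1 0) n u) => //.
  by move=> x y /eqP-> /eqP->; rewrite subr0 inE.
by move=> g /u0 ->; rewrite inE.
Qed.

Definition bits (v : heisenberg -> bool) h : R := (v h)%:R.

Lemma bounded_bits (v : heisenberg -> bool) : bounded_by 1 (bits v).
Proof. by move=> h; rewrite /bits; case: (v h); rewrite ?normr1 ?normr0. Qed.

(* [p] is divided by (1 - z)^4 and lifted to [P] with a binary defect, so [P] is
   recovered from its defect by a sum which is finite on each level. Only the
   level [l], where the recursion starts, contributes an error. *)
Lemma potential_approx_onto l p : harmonic_above l p ->
  exists r : heisenberg -> bool, forall h, l <= lev h ->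
  exists2 k : R, k \is a Num.int &
    `|potential (bits r) h - p h - k| <= 3 * (64 * 256) / `|(lev h - l)%R|.+1%:R.
Proof.
move=> hp; have [q hq <-] := iter_zdiff_onto_harmonic 4 hp.
have [P [Pq P0 Pl Pr]] := binary_lift hq.
pose s h := 2 * (P h - avg P h).
pose r h := (l < lev h) && (s h == 1).
(* The part of the defect that [r] misses: it lives on level [l], where s = 2 P lies in [0, 2]. *)
pose e h := 1 * (s h - bits r h).
have e0 h : lev h <> l -> e h = 0.
  move=> /eqP; rewrite neq_lt /e /bits /r => /orP[lh|lh].
    rewrite lt_gtF//= /s /avg !P0 ?lev_xV ?lev_yV//; last 2 first.
    - by lia.
    - by lia.
    by rewrite addr0 mul0r !subr0 mulr0 mul1r.
  rewrite lh mul1r /=; have [sh|sh] := Pr _ lh; rewrite -/(s h) in sh.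
    by rewrite sh eq_sym oner_eq0 subrr.
  by rewrite sh eqxx subrr.
have be : bounded_by 2 e.
  move=> h; have [lh|/eqP/e0 ->] := eqVneq (lev h) l; last by rewrite normr0.
  rewrite /e /bits /r lh ltxx subr0 mul1r /s /avg.
  rewrite (P0 (h * heis_x^-1)%g) ?(P0 (h * heis_y^-1)%g) ?lev_xV ?lev_yV ?lh.
  - by have := Pl _ lh; rewrite ler_norml => /andP[? ?]; apply/andP; split; lra.
  - by lia.
  - by lia.
exists r => h lh; set m := `|(lev h - l)%R|%N.
have hm : lev h = l + m%:Z by rewrite /m; lia.
exists (iter 4 zdiff P h - iter 4 zdiff q h).
  have -> : iter 4 zdiff P h - iter 4 zdiff q h =
      iter 4 zdiff (fun h => 1 * (P h - q h)) h.
    by rewrite iter_zdiff_lin mul1r.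
  apply: (@iter_zdiff_lev (fun k => l <= k)) => //.
    by move=> x y; exact: rpredB.
  by move=> g /Pq; rewrite mul1r.
(* From level l + m, m + 1 steps down lead below [l], where [P] vanishes. *)
have Q0 : iter m.+1 avg (iter 4 zdiff P) h = 0.
  apply: (@iter_avg_lev0 (fun k => k < l)); last by rewrite hm; lia.
  by apply: (@iter_zdiff_lev0 (fun k => k < l)) => g; exact: P0.
(* The first m terms read only levels above [l]. Just one term of the truncation at m + 1 sees [e];
   its bound, with c = 2, and the tail for [bits r], with c = 1, add up to the factor 3. *)
have pe0 : partial_potential e m h = 0.
  rewrite /partial_potential big1 ?mul0r// => i _.
  apply: (@iter_avg_lev0 (fun k => k <> l)).
    exact: (@iter_zdiff_lev0 (fun k => k <> l)).
  by rewrite hm; have := ltn_ord i; lia.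
have := partial_potential_lin 1 s (bits r) m.+1 h; rewrite -/e mul1r.
rewrite /s partial_potential_defect Q0 subr0.
have := partial_potential_tail h be (leqnSn m); rewrite pe0 subr0.
have := potential_approx m.+1 h (bounded_bits r).
have : m.+2%:R^-1 <= m.+1%:R^-1 :> R by rewrite lef_pV2 ?posrE// ler_nat.
move: (m.+2%:R^-1) (m.+1%:R^-1) => i j ij.
rewrite !ler_norml => /andP[? ?] /andP[? ?] ?; apply/andP; split; lra.
Qed.

End Approximation.

(** * The cover *)

Lemma rho_trinomial (R : realType) (G : groupType) (a b : G)
    (v : {ptws G -> circle R}) h :
  1%g != a -> 1%g != b -> a != b ->
  rho (gr_mon 2 1%g - gr_mon 1 a - gr_mon 1 b) v h =
  v h *+ 2 - v (h * a)%g - v (h * b)%g.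
Proof.
move=> a1 b1 ab; set f := _ - _ - _.
have fE g : mcoeff g f = 2 *+ (1%g == g) - 1 *+ (a == g) - 1 *+ (b == g).
  by rewrite !mcoeffB !mcoeffU.
have fD : (msupp f `<=` 1%g |` (a |` [fset b]))%fset.
  apply/fsubsetP => g; rewrite -mcoeff_neq0 fE !inE !(eq_sym g).
  apply: contraR; rewrite !negb_or => /and3P[/negbTE-> /negbTE-> /negbTE->].
  by rewrite !subr0.
rewrite /rho (big_fset_incl _ fD) /=; last by move=> g _ /mcoeff_outdom ->.
rewrite !big_fsetU1 ?inE ?negb_or ?a1 ?b1 ?ab//= big_seq_fset1 !fE !eqxx.
rewrite (eq_sym a 1%g) !(eq_sym b) (negbTE a1) (negbTE b1) (negbTE ab).
rewrite /right_shift mulg1 !subr0 !sub0r !mulrNz !mulr1z.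
by rewrite addrA.
Qed.

(** * The circle and membership in X_f *)

Section Circle.
Variable R : realType.
Implicit Types (s t : R) (h : heisenberg).

Definition to_circle t : circle R :=
  (\pi_(quotient_topology (Quotient.quot (integers R))) t)%qT.

Lemma to_circle_continuous : continuous to_circle.
Proof. exact: pi_continuous. Qed.

Lemma to_circleD s t : to_circle (s + t) = to_circle s + to_circle t.
Proof. exact: (@Quotient.pi_add _ (integers R)). Qed.

Lemma to_circleN t : to_circle (- t) = - to_circle t.
Proof. exact: (@Quotient.pi_opp _ (integers R)). Qed.

Lemma to_circle_eq s t : to_circle s = to_circle t <-> s - t \is a Num.int.
Proof.
have E := @Quotient.idealrBE _ (integers R) s t.
by rewrite -[_ \is a _]/(s - t \in integers R) E; split=> [st|/eqP //]; apply/eqP.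
Qed.

Lemma to_circle_surj (a : circle R) : exists t, to_circle t = a.
Proof. by exists (repr a); exact: reprK. Qed.

Lemma to_circle_lift (a : heisenberg -> circle R) :
  exists p : heisenberg -> R, a = to_circle \o p.
Proof.
have [p pa] := choice (fun h => to_circle_surj (a h)).
by exists p; apply/funext => h /=; rewrite pa.
Qed.

Definition heis_f : group_ring heisenberg :=
  gr_mon 2 1%g - gr_mon 1 heis_x^-1%g - gr_mon 1 heis_y^-1%g.

Lemma rho_heis_fE (v : {ptws heisenberg -> circle R}) h :
  rho heis_f v h = v h *+ 2 - v (h * heis_x^-1)%g - v (h * heis_y^-1)%g.
Proof.
have x1 : 1%g != heis_x^-1%g.
  by rewrite heis_1E heis_xVE; apply/eqP => /(congr1 lev); rewrite !lev_elt.
have y1 : 1%g != heis_y^-1%g.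
  by rewrite heis_1E heis_yVE; apply/eqP => /(congr1 lev); rewrite !lev_elt.
have xy : heis_x^-1%g != heis_y^-1%g.
  rewrite heis_xVE heis_yVE; apply/eqP.
  by move=> /(congr1 (fun g : heisenberg => g 0 1)); rewrite !heis_elt01.
exact: (rho_trinomial v h x1 y1 xy).
Qed.

Lemma XspaceE (p : heisenberg -> R) :
  Xspace R heis_f (to_circle \o p) <->
  forall h, 2 * (p h - avg p h) \is a Num.int.
Proof.
have E h : rho heis_f (to_circle \o p) h = to_circle (2 * (p h - avg p h)).
  rewrite rho_heis_fE /= mulr2n -!to_circleN -!to_circleD; congr to_circle.
  by rewrite /avg; field.
have z0 : to_circle 0 = 0 by rewrite -(subrr (to_circle 0)) -to_circleN -to_circleD subr0.
split=> [pX h|pZ].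
  rewrite -[X in X \is a _]subr0; apply/to_circle_eq.
  by rewrite -E z0; exact: (congr1 (fun u => u h) pX).
by apply/funext => h; rewrite E -z0; apply/to_circle_eq; rewrite subr0.
Qed.

End Circle.

Arguments to_circle {R} t.

(** * Continuity, surjectivity and equivariance of the cover *)

Section CoverMap.
Variable R : realType.
Implicit Types (v : {ptws heisenberg -> bool}) (h : heisenberg).

Lemma continuous_iter_op (op : (heisenberg -> R) -> heisenberg -> R)
    (F : {ptws heisenberg -> bool} -> heisenberg -> R) n :
  (forall G : {ptws heisenberg -> bool} -> heisenberg -> R,
    (forall h, continuous (G ^~ h)) -> forall h, continuous (fun v => op (G v) h)) ->
  (forall h, continuous (F ^~ h)) ->
  forall h, continuous (fun v => iter n op (F v) h).
Proof.
move=> cop cF; elim: n => // n IH.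
exact: (cop (fun v => iter n op (F v))).
Qed.

Lemma continuous_partial_potential n h :
  continuous (fun v => partial_potential (bits R v) n h).
Proof.
have c0 k : continuous (fun v => bits R v k).
  have cb : continuous (fun b : bool => b%:R : R).
    move=> b U /nbhs_singleton Ub; apply: (@filterS _ (nbhs b) _ [set b]).
      by move=> _ ->.
    exact: discrete_set1.
  move=> v; apply: (@continuous_comp _ _ _
    (fun w : {ptws heisenberg -> bool} => w k) (fun b : bool => b%:R : R)).
    exact: (@proj_continuous _ (fun=> bool)).
  exact: cb.
have cz : forall k, continuous (fun v => iter 4 zdiff (bits R v) k).
  apply: (@continuous_iter_op zdiff) => // G cG k v.
  by apply: cvgB; exact: cG.
have ca i : forall k, continuous (fun v => iter i avg (iter 4 zdiff (bits R v)) k).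
  apply: (@continuous_iter_op avg) => // G cG k v.
  by apply: cvgMl; apply: cvgD; exact: cG.
move=> v; apply: cvgMl; apply: cvg_big => [|i _]; last exact: ca.
exact: add_continuous.
Qed.

(** A uniform limit of continuous functions: the tail bound is the same for all binary
    configurations. *)
Lemma continuous_potential h : continuous (fun v => potential (bits R v) h).
Proof.
move=> v; apply/cvgrPdist_lt => e e0.
pose n := Num.truncn (64 * (256 * 1) / (e / 3)).
have ap w : `|potential (bits R w) h - partial_potential (bits R w) n h| < e / 3.
  apply: le_lt_trans (potential_approx _ _ (bounded_bits R w)) _.
  rewrite ltr_pdivrMr// [e / 3 * _]mulrC -ltr_pdivrMr ?divr_gt0//.
  exact: truncnS_gt.
have /cvgrPdist_lt/(_ (e / 3)) := @continuous_partial_potential n h v.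
rewrite divr_gt0// => /(_ isT); apply: filterS => w.
have := ap v; have := ap w.
rewrite !ltr_norml => /andP[? ?] /andP[? ?] /andP[? ?]; apply/andP; split; lra.
Qed.

(** The integers are closed: a non-integer has positive distance from its floor and from the next
    integer. *)
Lemma int_approx (x : R) :
  (forall e, 0 < e -> exists2 k, k \is a Num.int & `|x - k| < e) ->
  x \is a Num.int.
Proof.
move=> xk; have /andP[fx xf] := floor_itv x.
have [<-|fx'] := eqVneq ((Num.floor x)%:~R) x; first exact: intr_int.
have {}fx : (Num.floor x)%:~R < x by rewrite lt_neqAle fx' fx.
have : 0 < Num.min (x - (Num.floor x)%:~R) ((Num.floor x + 1)%:~R - x).
  by rewrite lt_min !subr_gt0 fx xf.
move=> /xk[_ /intrP[k ->]]; rewrite lt_min !ltr_norml => /andP[/andP[_ k1] /andP[k2 _]].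
have : (Num.floor x)%:~R < k%:~R :> R by lra.
have : k%:~R < (Num.floor x + 1)%:~R :> R by lra.
by rewrite !ltr_int; lia.
Qed.

Lemma full_shift_compact : compact [set: {ptws heisenberg -> bool}].
Proof.
have := @tychonoff heisenberg (fun=> bool) (fun=> setT) (fun=> bool_compact).
by congr (compact _); rewrite eqEsubset.
Qed.

Lemma potential_onto (p : heisenberg -> R) :
  (forall h, 2 * (p h - avg p h) \is a Num.int) ->
  exists v, forall h, potential (bits R v) h - p h \is a Num.int.
Proof.
move=> hp.
have /choice[r rP] (n : nat) := @potential_approx_onto R (- n%:Z) p (fun h _ => hp h).
pose F : set_system {ptws heisenberg -> bool} :=
  (r n : {ptws heisenberg -> bool}) @[n --> \oo].
have FF : ProperFilter F by exact: fmap_proper_filter.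
(* A cluster point is enough: for each [h] and [e], some [r n] with n large is close to [v] in
   potential at [h]. *)
have [v [_ clv]] := full_shift_compact FF filterT.
exists v => h; apply: int_approx => e e0.
pose e' := e / 2; have e'0 : 0 < e' by rewrite divr_gt0.
have /cvgrPdist_lt/(_ _ e'0) near_v := @continuous_potential h v.
have near_r : F [set w : {ptws heisenberg -> bool} | exists2 k : R, k \is a Num.int &
    `|potential (bits R w) h - p h - k| < e'].
  exists (`|lev h| + Num.truncn (3 * (64 * 256) / e'))%N => // n /= hn.
  have ln : - n%:Z <= lev h by lia.
  have [k kZ kle] := rP n h ln; exists k => //.
  apply: le_lt_trans kle _.
  rewrite ltr_pdivrMr// [e' * _]mulrC -ltr_pdivrMr//.
  apply: lt_le_trans (truncnS_gt _) _; rewrite ler_nat.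
  by move: hn; move: (Num.truncn _) => ?; lia.
have [w [[k kZ kw] vw]] := clv _ _ near_r near_v.
exists k => //; move: kw vw; rewrite /= !ltr_norml /e' => /andP[? ?] /andP[? ?].
by apply/andP; split; lra.
Qed.

Lemma cover_map_Xspace v :
  Xspace R heis_f (to_circle \o potential (bits R v)).
Proof.
apply/XspaceE => h; rewrite (potential_avg _ (bounded_bits R v)).
apply: (@iter_zdiff_lev _ (fun=> True)) => //.
  by move=> x y; exact: rpredB.
by move=> g _; rewrite /bits; exact: natr_int.
Qed.

Definition cover_map v : Xspace R heis_f :=
  exist (fun u => u \in Xspace R heis_f) (to_circle \o potential (bits R v))
    (mem_set (cover_map_Xspace v)).

Lemma continuous_cover_map : continuous cover_map.
Proof.
(* The subspace topology is initial and the product topology is a supremum of initial ones, so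
   single coordinates suffice. *)
apply: continuous_comp_initial => v; apply/cvg_sup => h.
apply: (@continuous_comp_initial _ _ _ (fun u : {ptws heisenberg -> circle R} => u h)
  (fun v => to_circle \o potential (bits R v))) => {}v.
apply: (@continuous_comp _ _ _ (fun v => potential (bits R v) h) to_circle).
  exact: continuous_potential.
exact: to_circle_continuous.
Qed.

Lemma cover_map_onto : range cover_map = [set: Xspace R heis_f].
Proof.
apply/seteqP; split=> // a _.
have [p pa] := to_circle_lift (\val a).
have /XspaceE/potential_onto[v vp] : Xspace R heis_f (to_circle \o p).
  by rewrite -pa; exact: set_valP.
exists v => //; apply/val_inj; rewrite /= pa.
by apply/funext => h; exact/to_circle_eq.
Qed.

Lemma cover_map_equivariant (g : heisenberg) v :
  cover_map (left_shift g v) = alpha g (cover_map v).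
Proof.
apply/val_inj/funext => h; congr to_circle.
exact: (potential_shift (bits R v)).
Qed.

End CoverMap.

Theorem theorem5p8 (R : realType) :
  let f : group_ring heisenberg :=
    gr_mon 2 1%g - gr_mon 1 heis_x^-1%g - gr_mon 1 heis_y^-1%g in
  exists xi : {ptws heisenberg -> bool} -> Xspace R f,
    [/\ continuous xi,
        range xi = [set: Xspace R f] &
        forall (g : heisenberg) (v : {ptws heisenberg -> bool}),
          xi (left_shift g v) = alpha g (xi v)].
Proof.
exists (@cover_map R); split.
- exact: continuous_cover_map.
- exact: cover_map_onto.
- exact: cover_map_equivariant.
Qed.
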